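(* Assume the setting described in the context, and assume that the proof system $P_{\mathit{Oper},\mathit{Term}}$ is sound. Then every rule of the proof system $\mathcal{DL}_p$ listed in the context is sound; that is, for every instance of each rule, if the formulas $\mathfrak{P}(\nu_1),\dots,\mathfrak{P}(\nu_n)$ of all its premises $\nu_1,\dots,\nu_n$ are valid, then the formula $\mathfrak{P}(\nu)$ of its conclusion $\nu$ is valid.
   Context: Parameterized dynamic logic ($DL_p$). Fix a set $\mathbf{T}$ of terms built over a set of variables and a set $\Sigma$ of signatures (function symbols, constants being $0$-ary), with three distinguished subsets $\mathit{Prog}$ (programs), $\mathit{Conf}$ (configurations) and $\mathit{Fmla}$ (formulas); $\equiv$ denotes syntactic identity of terms. A function $f:\mathbf{T}\to\mathbf{T}$ is structural if for every $n$-ary $s\in\Sigma$ and terms $t_1,\dots,t_n$, $f(s(t_1,\dots,t_n))\equiv s(f_1(t_1),\dots,f_n(t_n))$ for some structural $f_1,\dots,f_n$, and $f$ maps programs to programs, configurations to configurations and formulas to formulas. $\mathit{Prog}$ contains a distinguished program $\downarrow$ (termination). There is a function $\mathit{app}:\mathit{Conf}\times\mathit{Fmla}\to\mathit{Fmla}$ (configuration interpretation). There is a set $\mathit{Prop}\subseteq\mathit{Fmla}$ of propositions with a truth function $\mathcal B:\mathit{Prop}\to\{0,1\}$, and a set $\mathit{Eval}$ of evaluations: structural functions $\rho$ mapping every formula to a proposition. Write $\rho\models\phi$ iff $\mathcal B(\rho(\phi))=1$; $\phi$ is valid iff $\rho\models\phi$ for all $\rho\in\mathit{Eval}$. A program state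 is a pair $(\alpha,\sigma)\in\mathit{Prog}\times\mathit{Conf}$. $\mathit{Fmla}$ contains transition formulas $(\alpha,\sigma)\to(\alpha',\sigma')$ and termination formulas $(\alpha,\sigma)\Downarrow$, with $\rho$ acting componentwise on them. $\mathit{Oper}$ is the set of transition formulas that are propositions with truth value $1$; it is assumed that no transition in $\mathit{Oper}$ starts from a state $(\downarrow,\sigma)$. A path is a finite or infinite sequence of states $s_1s_2\dots$ with $s_i\to s_{i+1}\in\mathit{Oper}$ for all $i$; it is terminal if it is finite and its last state has program $\downarrow$; it is minimum if no state occurs twice. $\mathcal B((\alpha,\sigma)\Downarrow)=1$ iff there is a terminal path from $(\alpha,\sigma)$; $\mathit{Term}$ is the set of true termination formulas. Standing assumptions: from each state there are only finitely many transitions in $\mathit{Oper}$, and only finitely many minimum terminal paths. $DL_p$ formulas: $\psi::=F\mid\neg\psi\mid\psi\wedge\psi\mid[\alpha]\psi$ and $\phi::=F\mid\sigma:\psi\mid\neg\phi\mid\phi\wedge\phi$, with $F\in\mathit{Fmla}$, $\alpha\in\mathit{Prog}$, $\sigma\in\mathit{Conf}$; $\langle\alpha\rangle\psi$ abbreviates $\neg[\alpha]\neg\psi$. Evaluations extend structurally to these formulas, yielding propositions with truth values: $\mathcal B(\rho(F))$ as given for $F\in\mathit{Fmla}$; $\rho\models\sigma:F$ iff $\rho\models\mathit{app}(\sigma,F)$ for $F\in\mathit{Fmla}$; $\sigma:\neg\psi$ has the value of $\neg(\sigma:\psi)$; $\sigma:(\psi_1\wedge\psi_2)$ has the value of $(\sigma:\psi_1)\wedge(\sigma:\psi_2)$;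 $\rho\models\sigma:[\alpha]\psi$ iff for every terminal path $(\alpha_1,\sigma_1)\dots(\downarrow,\sigma_n)$ with $(\alpha_1,\sigma_1)\equiv\rho(\alpha,\sigma)$, $\rho\models\sigma_n:\psi$; $\neg$ and $\wedge$ are classical; otherwise false. A sequent $\Gamma\Rightarrow\Delta$ ($\Gamma,\Delta$ finite multisets of formulas) denotes the formula $\mathfrak P(\Gamma\Rightarrow\Delta)=\bigwedge\Gamma\to\bigvee\Delta$. A rule is sound if validity of the formulas of all premises implies validity of the formula of the conclusion. $P_{\mathit{Oper},\mathit{Term}}$ is a given proof system for sequents possibly containing transition and termination formulas; $\vdash_P\nu$ means $\nu$ is derivable in it; it is assumed complete w.r.t. $\mathit{Oper}$ and $\mathit{Term}$: a transition proposition is in $\mathit{Oper}$ iff $\vdash_P\cdot\Rightarrow$ (that transition), and a termination proposition is in $\mathit{Term}$ iff $\vdash_P\cdot\Rightarrow$ (that termination). Sound means every derivable sequent is valid. A substitution is a structural $\eta:\mathbf T\to\mathbf T$ such that for each $\rho\in\mathit{Eval}$ there is $\rho'\in\mathit{Eval}$ with $\rho(\eta(\phi))\equiv\rho'(\phi)$ for every $DL_p$ formula $\phi$. A ''double-lined'' rule with conclusion $\phi$ and premises $\phi_1,\dots,\phi_n$ stands for both rules $\frac{\Gamma\Rightarrow\phi_1,\Delta\ \cdots\ \Gamma\Rightarrow\phi_n,\Delta}{\Gamma\Rightarrow\phi,\Delta}$ and $\frac{\Gamma,\phi_1\Rightarrow\Delta\ \cdots\ \Gamma,\phi_n\Rightarrow\Delta}{\Gamma,\phi\Rightarrow\Delta}$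 for arbitrary $\Gamma,\Delta$. Rules of $\mathcal{DL}_p$ ($\Gamma,\Delta$ arbitrary): ($[\alpha]$) for $\alpha\not\equiv\downarrow$: from the premises $\Gamma\Rightarrow\sigma':[\alpha']\phi,\Delta$ for all $(\alpha',\sigma')\in\Phi$, where $\Phi=\{(\alpha',\sigma')\mid\ \vdash_P\Gamma\Rightarrow(\alpha,\sigma)\to(\alpha',\sigma'),\Delta\}$, infer $\Gamma\Rightarrow\sigma:[\alpha]\phi,\Delta$. ($\langle\alpha\rangle$) for $\alpha\not\equiv\downarrow$: from $\Gamma\Rightarrow\sigma':\langle\alpha'\rangle\phi,\Delta$ infer $\Gamma\Rightarrow\sigma:\langle\alpha\rangle\phi,\Delta$, provided $\vdash_P\Gamma\Rightarrow(\alpha,\sigma)\to(\alpha',\sigma'),\Delta$. (Ter): $\Gamma\Rightarrow\Delta$ with no premises, if all formulas of $\Gamma,\Delta$ lie in $\mathit{Fmla}$ and $\mathfrak P(\Gamma\Rightarrow\Delta)$ is valid. (Int), double-lined: from $\mathit{app}(\sigma,\phi)$ to $\sigma:\phi$, for $\phi\in\mathit{Fmla}$ without dynamic parts. ($[\downarrow]$), double-lined: from $\sigma:\phi$ to $\sigma:[\downarrow]\phi$. (Sub): from $\Gamma\Rightarrow\Delta$ infer $\eta(\Gamma)\Rightarrow\eta(\Delta)$ for a substitution $\eta$. ($\sigma\neg$), double-lined: from $\neg(\sigma:\phi)$ to $\sigma:\neg\phi$. ($\sigma\wedge$), double-lined: from $(\sigma:\phi)\wedge(\sigma:\psi)$ to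 $\sigma:(\phi\wedge\psi)$. (ax): $\Gamma,\phi\Rightarrow\phi,\Delta$. (Cut): from $\Gamma\Rightarrow\phi,\Delta$ and $\Gamma,\phi\Rightarrow\Delta$ infer $\Gamma\Rightarrow\Delta$. (Wk L): from $\Gamma\Rightarrow\Delta$ infer $\Gamma,\phi\Rightarrow\Delta$. (Wk R): from $\Gamma\Rightarrow\Delta$ infer $\Gamma\Rightarrow\phi,\Delta$. (Con), double-lined: from $\phi,\phi$ to $\phi$. ($\neg L$): from $\Gamma\Rightarrow\phi,\Delta$ infer $\Gamma,\neg\phi\Rightarrow\Delta$. ($\neg R$): from $\Gamma,\phi\Rightarrow\Delta$ infer $\Gamma\Rightarrow\neg\phi,\Delta$. ($\wedge L$): from $\Gamma,\phi,\psi\Rightarrow\Delta$ infer $\Gamma,\phi\wedge\psi\Rightarrow\Delta$. ($\wedge R$): from $\Gamma\Rightarrow\phi,\Delta$ and $\Gamma\Rightarrow\psi,\Delta$ infer $\Gamma\Rightarrow\phi\wedge\psi,\Delta$.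
   Formalization: Added, since the literal claim fails: rule ([α]) applies only if, for every ρ satisfying Γ and refuting Δ, each Oper-transition of ρ(α,σ) leads to some ρ(α',σ') with (α',σ')∈Φ; evaluations satisfy ρ(ρ(σ))≡ρ(σ), and ρ(α)≡↓ only if α≡↓. *)

(* Defs.v *)
From Stdlib Require Import List Permutation.
From Stdlib Require Vector.
Import ListNotations.

Set Implicit Arguments.
Unset Strict Implicit.
Unset Printing Implicit Defensive.

(* [sym n] is the set of n-ary symbols.  Termination [stop_sym], transition
   formulas [trans_sym] and termination formulas [ter_sym] are symbols. *)
Record signature : Type := Signature {
  var : Type;
  sym : nat -> Type;
  stop_sym : sym 0;
  trans_sym : sym 4;
  ter_sym : sym 2
}.

Inductive term (S : signature) : Type :=
| Var (x : var S)
| Fn (n : nat) (s : sym S n) (ts : Vector.t (term S) n).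

Arguments Var {S} x.
Arguments Fn {S n} s ts.

Definition stop_tm (S : signature) : term S :=
  Fn (stop_sym S) (Vector.nil _).

Definition trans_tm (S : signature) (a s a' s' : term S) : term S :=
  Fn (trans_sym S)
     (Vector.cons _ a _ (Vector.cons _ s _
       (Vector.cons _ a' _ (Vector.cons _ s' _ (Vector.nil _))))).

Definition ter_tm (S : signature) (a s : term S) : term S :=
  Fn (ter_sym S) (Vector.cons _ a _ (Vector.cons _ s _ (Vector.nil _))).

(* The three sorts are subsets of the terms.  By proof irrelevance, equality in
   the subset types [prog], [conf], [fmla] below is identity of terms.
   [conf0] is only used to write down a tautology (see [top]). *)
Record language : Type := Language {
  sg :> signature;
  Prog : term sg -> Prop;
  Conf : term sg -> Prop;
  Fmla : term sg -> Prop;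
  stop_Prog : Prog (stop_tm sg);
  trans_Fmla : forall a s a' s',
    Prog a -> Conf s -> Prog a' -> Conf s' -> Fmla (trans_tm a s a' s');
  ter_Fmla : forall a s, Prog a -> Conf s -> Fmla (ter_tm a s);
  conf0 : {t : term sg | Conf t};
  app : {t : term sg | Conf t} -> {t : term sg | Fmla t} ->
        {t : term sg | Fmla t}
}.

Definition prog (L : language) : Type := {t : term L | @Prog L t}.
Definition conf (L : language) : Type := {t : term L | @Conf L t}.
Definition fmla (L : language) : Type := {t : term L | @Fmla L t}.
Definition state (L : language) : Type := (prog L * conf L)%type.

Definition stop (L : language) : prog L :=
  exist _ (stop_tm L) (stop_Prog L).

Definition trans (L : language) (st st' : state L) : fmla L :=
  exist _ _ (trans_Fmla (proj2_sig (fst st)) (proj2_sig (snd st))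
                        (proj2_sig (fst st')) (proj2_sig (snd st'))).

Definition ter (L : language) (st : state L) : fmla L :=
  exist _ _ (ter_Fmla (proj2_sig (fst st)) (proj2_sig (snd st))).

(* The definition is self-referential with no base case, hence coinductive. *)
CoInductive structural (L : language) (f : term L -> term L) : Prop :=
  Structural {
    structural_Fn : forall n (s : sym L n) (ts : Vector.t (term L) n),
      exists fs : Vector.t (term L -> term L) n,
        (forall i : Fin.t n, structural (Vector.nth fs i)) /\
        f (Fn s ts) = Fn s (Vector.map2 (fun g t => g t) fs ts);
    structural_Prog : forall t, @Prog L t -> @Prog L (f t);
    structural_Conf : forall t, @Conf L t -> @Conf L (f t);
    structural_Fmla : forall t, @Fmla L t -> @Fmla L (f t)
  }.

Record smap (L : language) : Type := SMap {
  smap_fun :> term L -> term L;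
  smap_structural : structural smap_fun
}.

Definition on_prog (L : language) (f : smap L) (a : prog L) : prog L :=
  exist _ (f (proj1_sig a))
        (structural_Prog (smap_structural f) (proj2_sig a)).
Definition on_conf (L : language) (f : smap L) (s : conf L) : conf L :=
  exist _ (f (proj1_sig s))
        (structural_Conf (smap_structural f) (proj2_sig s)).
Definition on_fmla (L : language) (f : smap L) (F : fmla L) : fmla L :=
  exist _ (f (proj1_sig F))
        (structural_Fmla (smap_structural f) (proj2_sig F)).
Definition on_state (L : language) (f : smap L) (st : state L) : state L :=
  (on_prog f (fst st), on_conf f (snd st)).

Inductive udl (L : language) : Type :=
| UFml (F : fmla L)
| UNeg (p : udl L)
| UAnd (p q : udl L)
| UBox (a : prog L) (p : udl L).

Definition UDia (L : language) (a : prog L) (p : udl L) : udl L :=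
  UNeg (UBox a (UNeg p)).

Inductive dl (L : language) : Type :=
| DFml (F : fmla L)
| DLab (s : conf L) (p : udl L)
| DNeg (p : dl L)
| DAnd (p q : dl L).

Fixpoint on_udl (L : language) (f : smap L) (p : udl L) : udl L :=
  match p with
  | UFml F => UFml (on_fmla f F)
  | UNeg p => UNeg (on_udl f p)
  | UAnd p q => UAnd (on_udl f p) (on_udl f q)
  | UBox a p => UBox (on_prog f a) (on_udl f p)
  end.

Fixpoint on_dl (L : language) (f : smap L) (p : dl L) : dl L :=
  match p with
  | DFml F => DFml (on_fmla f F)
  | DLab s p => DLab (on_conf f s) (on_udl f p)
  | DNeg p => DNeg (on_dl f p)
  | DAnd p q => DAnd (on_dl f p) (on_dl f q)
  end.

Definition DOr (L : language) (p q : dl L) : dl L := DNeg (DAnd (DNeg p) (DNeg q)).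
Definition DImp (L : language) (p q : dl L) : dl L := DNeg (DAnd p (DNeg q)).

Definition top (L : language) : dl L :=
  let F := DFml (ter (stop L, conf0 L)) in DOr F (DNeg F).

(* Finite multisets are represented by lists. *)
Record sequent (L : language) : Type :=
  Sequent { ante : list (dl L); succ : list (dl L) }.

Notation "G ==>> D" := (Sequent G D) (at level 90, no associativity).

Definition seq_fml (L : language) (nu : sequent L) : dl L :=
  DImp (fold_right (@DAnd L) (top L) (ante nu))
       (fold_right (@DOr L) (DNeg (top L)) (succ nu)).

(* [B] is the truth function on propositions; [truth] is its extension to
   evaluated DL_p formulas, constrained by the clauses of [DLp_setting]. *)
Record frame (L : language) : Type := Frame {
  Propn : term L -> Prop;
  B : {t : term L | Propn t} -> bool;
  Eval : smap L -> Prop;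
  truth : dl L -> bool;
  derivP : sequent L -> Prop
}.

Definition sat (L : language) (M : frame L) (rho : smap L) (p : dl L) : Prop :=
  truth M (on_dl rho p) = true.

Definition valid (L : language) (M : frame L) (p : dl L) : Prop :=
  forall rho, Eval M rho -> sat M rho p.

Definition true_prop (L : language) (M : frame L) (F : fmla L) : Prop :=
  exists h : Propn M (proj1_sig F), B (exist _ (proj1_sig F) h) = true.

Definition Oper (L : language) (M : frame L) (st st' : state L) : Prop :=
  true_prop M (trans st st').

(* [path_from M st l]: the sequence [st :: l] is a finite path. *)
Fixpoint path_from (L : language) (M : frame L) (st : state L)
    (l : list (state L)) : Prop :=
  match l with
  | nil => True
  | st' :: l' => Oper M st st' /\ path_from M st' l'
  end.

Definition terminal_path (L : language) (M : frame L) (st : state L)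
    (l : list (state L)) : Prop :=
  path_from M st l /\ fst (last l st) = stop L.

Definition minimum (L : language) (st : state L) (l : list (state L)) : Prop :=
  NoDup (st :: l).

Record DLp_setting (L : language) (M : frame L) : Prop := DLpSetting {
  Propn_Fmla : forall t, Propn M t -> @Fmla L t;

  eval_Propn : forall rho t, Eval M rho -> @Fmla L t -> Propn M (rho t);
  eval_trans : forall rho st st', Eval M rho ->
    on_fmla rho (trans st st') = trans (on_state rho st) (on_state rho st');
  eval_ter : forall rho st, Eval M rho ->
    on_fmla rho (ter st) = ter (on_state rho st);
  (* Evaluated configurations are closed: evaluating them again is harmless. *)
  eval_conf_idem : forall rho s, Eval M rho ->
    on_conf rho (on_conf rho s) = on_conf rho s;
  (* Automatic for programs other than a bare variable, as evaluations preserve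
     the head symbol. *)
  eval_stop_inv : forall rho a, Eval M rho ->
    on_prog rho a = stop L -> a = stop L;

  Oper_stop : forall s st', ~ Oper M (stop L, s) st';
  B_ter : forall st (h : Propn M (proj1_sig (ter st))),
    B (exist _ _ h) = true <-> exists l, terminal_path M st l;
  Oper_finite : forall st, exists sts : list (state L),
    forall st', Oper M st st' -> In st' sts;
  min_paths_finite : forall st, exists ls : list (list (state L)),
    forall l, terminal_path M st l -> minimum st l -> In l ls;

  truth_Fml : forall (rho : smap L) (F : fmla L) (h : Propn M (rho (proj1_sig F))), Eval M rho ->
    truth M (on_dl rho (DFml F)) = B (exist _ _ h);
  sat_lab_Fml : forall rho s F, Eval M rho ->
    sat M rho (DLab s (UFml F)) <-> sat M rho (DFml (app s F));
  sat_lab_neg : forall rho s p, Eval M rho ->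
    sat M rho (DLab s (UNeg p)) <-> sat M rho (DNeg (DLab s p));
  sat_lab_and : forall rho s p q, Eval M rho ->
    sat M rho (DLab s (UAnd p q)) <-> sat M rho (DAnd (DLab s p) (DLab s q));
  sat_lab_box : forall rho s a p, Eval M rho ->
    sat M rho (DLab s (UBox a p)) <->
    forall l, terminal_path M (on_state rho (a, s)) l ->
      sat M rho (DLab (snd (last l (on_state rho (a, s)))) p);
  sat_neg : forall rho p, Eval M rho ->
    sat M rho (DNeg p) <-> ~ sat M rho p;
  sat_and : forall rho p q, Eval M rho ->
    sat M rho (DAnd p q) <-> sat M rho p /\ sat M rho q;

  derivP_multiset : forall G G' D D', Permutation G G' -> Permutation D D' ->
    derivP M (G ==>> D) -> derivP M (G' ==>> D');
  derivP_Oper : forall st st', Propn M (proj1_sig (trans st st')) ->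
    Oper M st st' <-> derivP M ([] ==>> [DFml (trans st st')]);
  derivP_Term : forall st, Propn M (proj1_sig (ter st)) ->
    true_prop M (ter st) <-> derivP M ([] ==>> [DFml (ter st)])
}.

Definition soundP (L : language) (M : frame L) : Prop :=
  forall nu, derivP M nu -> valid M (seq_fml nu).

Definition substitution (L : language) (M : frame L) (eta : smap L) : Prop :=
  forall rho, Eval M rho -> exists rho', Eval M rho' /\
    forall p : dl L, on_dl rho (on_dl eta p) = on_dl rho' p.

Definition Phi (L : language) (M : frame L) (G D : list (dl L))
    (st st' : state L) : Prop :=
  derivP M (G ==>> DFml (trans st st') :: D).

(* Proviso of [rule_box]: Phi represents all transitions of the evaluated state.
   Without it the rule is unsound, even if P derives every valid sequent: the
   successors of rho(alpha, sigma) need not be uniformly of the form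
   rho(alpha', sigma'), in which case Phi may be empty although rho(alpha, sigma)
   has transitions. *)
Definition exhaustive (L : language) (M : frame L) (G D : list (dl L))
    (st : state L) : Prop :=
  forall rho, Eval M rho ->
    (forall p, In p G -> sat M rho p) ->
    (forall p, In p D -> ~ sat M rho p) ->
    forall st', Oper M (on_state rho st) st' ->
      exists st1, Phi M G D st st1 /\ on_state rho st1 = st'.

(* [DLp_rule M prems nu]: there is a rule instance with set of premises [prems]
   and conclusion [nu].  Suffixes [R] and [L] are the two readings of a
   double-lined rule. *)
Inductive DLp_rule (L : language) (M : frame L) :
    (sequent L -> Prop) -> sequent L -> Prop :=
| rule_box G D a s p :
    a <> stop L ->
    exhaustive M G D (a, s) ->
    DLp_rule M
      (fun nu => exists st', Phi M G D (a, s) st' /\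
         nu = (G ==>> DLab (snd st') (UBox (fst st') p) :: D))
      (G ==>> DLab s (UBox a p) :: D)
| rule_dia G D a s a' s' p :
    a <> stop L ->
    Phi M G D (a, s) (a', s') ->
    DLp_rule M (eq (G ==>> DLab s' (UDia a' p) :: D))
               (G ==>> DLab s (UDia a p) :: D)
| rule_Ter (G D : list (fmla L)) :
    valid M (seq_fml (map (@DFml L) G ==>> map (@DFml L) D)) ->
    DLp_rule M (fun _ => False) (map (@DFml L) G ==>> map (@DFml L) D)
| rule_Int_R G D s (F : fmla L) :
    DLp_rule M (eq (G ==>> DFml (app s F) :: D))
               (G ==>> DLab s (UFml F) :: D)
| rule_Int_L G D s (F : fmla L) :
    DLp_rule M (eq (DFml (app s F) :: G ==>> D))
               (DLab s (UFml F) :: G ==>> D)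
| rule_stop_R G D s p :
    DLp_rule M (eq (G ==>> DLab s p :: D))
               (G ==>> DLab s (UBox (stop L) p) :: D)
| rule_stop_L G D s p :
    DLp_rule M (eq (DLab s p :: G ==>> D))
               (DLab s (UBox (stop L) p) :: G ==>> D)
| rule_Sub G D eta :
    substitution M eta ->
    DLp_rule M (eq (G ==>> D))
               (map (on_dl eta) G ==>> map (on_dl eta) D)
| rule_lab_neg_R G D s p :
    DLp_rule M (eq (G ==>> DNeg (DLab s p) :: D))
               (G ==>> DLab s (UNeg p) :: D)
| rule_lab_neg_L G D s p :
    DLp_rule M (eq (DNeg (DLab s p) :: G ==>> D))
               (DLab s (UNeg p) :: G ==>> D)
| rule_lab_and_R G D s p q :
    DLp_rule M (eq (G ==>> DAnd (DLab s p) (DLab s q) :: D))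
               (G ==>> DLab s (UAnd p q) :: D)
| rule_lab_and_L G D s p q :
    DLp_rule M (eq (DAnd (DLab s p) (DLab s q) :: G ==>> D))
               (DLab s (UAnd p q) :: G ==>> D)
| rule_ax G D p :
    DLp_rule M (fun _ => False) (p :: G ==>> p :: D)
| rule_Cut G D p :
    DLp_rule M (fun nu => nu = (G ==>> p :: D) \/ nu = (p :: G ==>> D))
               (G ==>> D)
| rule_WkL G D p :
    DLp_rule M (eq (G ==>> D)) (p :: G ==>> D)
| rule_WkR G D p :
    DLp_rule M (eq (G ==>> D)) (G ==>> p :: D)
| rule_Con_R G D p :
    DLp_rule M (eq (G ==>> p :: p :: D)) (G ==>> p :: D)
| rule_Con_L G D p :
    DLp_rule M (eq (p :: p :: G ==>> D)) (p :: G ==>> D)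
| rule_negL G D p :
    DLp_rule M (eq (G ==>> p :: D)) (DNeg p :: G ==>> D)
| rule_negR G D p :
    DLp_rule M (eq (p :: G ==>> D)) (G ==>> DNeg p :: D)
| rule_andL G D p q :
    DLp_rule M (eq (p :: q :: G ==>> D)) (DAnd p q :: G ==>> D)
| rule_andR G D p q :
    DLp_rule M (fun nu => nu = (G ==>> p :: D) \/ nu = (G ==>> q :: D))
               (G ==>> DAnd p q :: D).

(* Main.v *)
Require Import Defs.
From Stdlib Require Import List ProofIrrelevance.
From Stdlib Require Vector.
Import ListNotations.

(** A sequent is valid iff no evaluation satisfies its whole antecedent and
    refutes its whole succedent, so soundness of a rule means that a
    countermodel of the conclusion is a countermodel of some premise.  For the
    two dynamic rules a terminal path from an evaluated non-[stop] state is a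
    first transition followed by a terminal path from its target; the
    transition is matched with a derivable transition formula by [exhaustive]
    for [rule_box], and supplied by soundness of P for [rule_dia]. *)

Lemma sig_ext (A : Type) (P : A -> Prop) (x y : {a | P a}) :
  proj1_sig x = proj1_sig y -> x = y.
Proof.
  destruct x as [x hx], y as [y hy]; simpl; intros <-.
  now rewrite (proof_irrelevance _ hx hy).
Qed.

Lemma last_cons (A : Type) (x d : A) (l : list A) : last (x :: l) d = last l x.
Proof.
  revert x d; induction l as [|y l IH]; intros x d; [reflexivity|].
  change (last (y :: l) d = last (y :: l) x); now rewrite !IH.
Qed.

(** [stop] is a nullary symbol, so the vector of component maps supplied by structurality is empty
    and nothing can change. *)
Lemma smap_stop (L : language) (f : smap L) : on_prog f (stop L) = stop L.
Proof.
  apply sig_ext; simpl; unfold stop_tm.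
  destruct (structural_Fn (smap_structural f) (stop_sym L) (Vector.nil _))
    as [fs [_ ->]].
  now rewrite (Vector.nil_spec fs).
Qed.

Lemma terminal_path_cons (L : language) (M : frame L) (st st' : state L)
    (l : list (state L)) :
  terminal_path M st (st' :: l) <-> Oper M st st' /\ terminal_path M st' l.
Proof. unfold terminal_path; rewrite last_cons; simpl; tauto. Qed.

Section Soundness.

Set Implicit Arguments.
Unset Strict Implicit.

Context (L : language) (M : frame L) (setting : DLp_setting M).

Lemma sat_or (rho : smap L) (p q : dl L) : Eval M rho ->
  sat M rho (DOr p q) <-> ~ (~ sat M rho p /\ ~ sat M rho q).
Proof.
  intros E; unfold DOr; rewrite (sat_neg setting), (sat_and setting),
    !(sat_neg setting) by assumption; tauto.
Qed.

Lemma sat_top (rho : smap L) : Eval M rho -> sat M rho (top L).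
Proof.
  intros E; unfold top; simpl; rewrite sat_or, (sat_neg setting) by assumption.
  tauto.
Qed.

Lemma sat_big_and (rho : smap L) (G : list (dl L)) : Eval M rho ->
  sat M rho (fold_right (@DAnd L) (top L) G) <-> Forall (sat M rho) G.
Proof.
  intros E; induction G as [|p G IH]; simpl.
  - split; intros _; [constructor | now apply sat_top].
  - rewrite (sat_and setting), IH, Forall_cons_iff by assumption; tauto.
Qed.

(** Disjunction is a De Morgan abbreviation, so its refutation, unlike its truth, splits into the
    disjuncts without classical reasoning. *)
Lemma unsat_big_or (rho : smap L) (D : list (dl L)) : Eval M rho ->
  ~ sat M rho (fold_right (@DOr L) (DNeg (top L)) D) <->
  Forall (fun p => ~ sat M rho p) D.
Proof.
  intros E; induction D as [|p D IH]; simpl.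
  - rewrite (sat_neg setting) by assumption.
    pose proof (sat_top E); split; [constructor | tauto].
  - rewrite sat_or, Forall_cons_iff, <- IH by assumption; tauto.
Qed.

Definition countermodel (rho : smap L) (G D : list (dl L)) : Prop :=
  Forall (sat M rho) G /\ Forall (fun p => ~ sat M rho p) D.

Lemma sat_seq_fml (rho : smap L) (G D : list (dl L)) : Eval M rho ->
  sat M rho (seq_fml (G ==>> D)) <-> ~ countermodel rho G D.
Proof.
  intros E; unfold seq_fml, DImp, countermodel; simpl.
  rewrite (sat_neg setting), (sat_and setting), (sat_neg setting), sat_big_and,
    unsat_big_or by assumption.
  reflexivity.
Qed.

Lemma sat_trans (rho : smap L) (st st' : state L) : Eval M rho ->
  sat M rho (DFml (trans st st')) ->
  Oper M (on_state rho st) (on_state rho st').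
Proof.
  intros E H; unfold Oper; rewrite <- (eval_trans setting) by assumption.
  set (h := eval_Propn setting E (proj2_sig (trans st st'))).
  exists h; exact (eq_trans (eq_sym (truth_Fml setting h E)) H).
Qed.

(** Needed because paths run through evaluated states: the empty path ends in [on_conf rho s], which
    is evaluated once more when the label is interpreted. *)
Lemma sat_lab_on_conf (rho : smap L) (s : conf L) (p : udl L) : Eval M rho ->
  sat M rho (DLab (on_conf rho s) p) <-> sat M rho (DLab s p).
Proof.
  intros E; unfold sat; simpl; now rewrite (eval_conf_idem setting).
Qed.

(** No transition leaves a [stop] state, so the empty path is its only terminal path. *)
Lemma sat_lab_box_stop (rho : smap L) (s : conf L) (p : udl L) : Eval M rho ->
  sat M rho (DLab s (UBox (stop L) p)) <-> sat M rho (DLab s p).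
Proof.
  intros E; rewrite (sat_lab_box setting), <- (sat_lab_on_conf s p E)
    by assumption.
  unfold on_state; simpl; rewrite smap_stop; split.
  - intros H; apply (H []); split; simpl; auto.
  - intros H [|st l] Hl; [exact H|].
    apply terminal_path_cons in Hl; destruct Hl as [Hst _].
    now apply (Oper_stop setting) in Hst.
Qed.

Lemma sat_lab_box_step (rho : smap L) (a : prog L) (s : conf L)
    (st : state L) (p : udl L) : Eval M rho ->
  Oper M (on_state rho (a, s)) (on_state rho st) ->
  sat M rho (DLab s (UBox a p)) ->
  sat M rho (DLab (snd st) (UBox (fst st) p)).
Proof.
  intros E O; rewrite !(sat_lab_box setting) by assumption; intros H l Hl.
  rewrite <- last_cons with (d := on_state rho (a, s)).
  apply H, terminal_path_cons; now split.
Qed.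

Lemma sat_lab_box_unfold (rho : smap L) (a : prog L) (s : conf L) (p : udl L) :
  Eval M rho -> a <> stop L ->
  (forall st', Oper M (on_state rho (a, s)) st' ->
     exists st1, on_state rho st1 = st' /\
       sat M rho (DLab (snd st1) (UBox (fst st1) p))) ->
  sat M rho (DLab s (UBox a p)).
Proof.
  intros E Ha H; apply (sat_lab_box setting); [assumption|].
  intros [|st' l] Hl.
  (* The empty path would be terminal only if [a] evaluated to [stop]. *)
  - destruct Hl as [_ Hl]; now apply (eval_stop_inv setting E) in Hl.
  - apply terminal_path_cons in Hl; destruct Hl as [O Hl].
    destruct (H _ O) as [[a1 s1] [<- H1]].
    rewrite last_cons.
    exact (proj1 (sat_lab_box setting s1 a1 p E) H1 l Hl).
Qed.

Lemma sat_lab_dia (rho : smap L) (a : prog L) (s : conf L) (p : udl L) :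
  Eval M rho ->
  sat M rho (DLab s (UDia a p)) <-> ~ sat M rho (DLab s (UBox a (UNeg p))).
Proof.
  intros E; unfold UDia.
  now rewrite (sat_lab_neg setting), (sat_neg setting).
Qed.

End Soundness.

Theorem theorem1 (L : language) (M : frame L) (setting : DLp_setting M)
    (P_sound : soundP M) (prems : sequent L -> Prop) (nu : sequent L) :
  DLp_rule M prems nu ->
  (forall nu', prems nu' -> valid M (seq_fml nu')) ->
  valid M (seq_fml nu).
Proof.
  intros R HP rho E.
  assert (HP' : forall G D, prems (G ==>> D) -> ~ countermodel M rho G D)
    by (intros G D H; apply (sat_seq_fml setting); [|apply HP]; assumption).
  destruct R as [G D a s p Ha Hex | G D a s a' s' p Ha Hphi | G D HV
    | G D s F | G D s F | G D s p | G D s p | G D eta Heta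
    | G D s p | G D s p | G D s p q | G D s p q | G D p | G D p
    | G D p | G D p | G D p | G D p | G D p | G D p | G D p q | G D p q ].
  (* Once the semantic clauses are unfolded, every rule except box, diamond, Ter and Sub is
     propositional. *)
  all: try (apply (sat_seq_fml setting); [assumption|];
    first [ pose proof (HP' _ _ eq_refl) as H1
          | pose proof (HP' _ _ (or_introl eq_refl)) as H1;
            pose proof (HP' _ _ (or_intror eq_refl)) as H2
          | idtac ];
    unfold countermodel in *; rewrite ?Forall_cons_iff in *;
    rewrite ?(sat_lab_Fml setting), ?(sat_lab_box_stop setting),
      ?(sat_lab_neg setting), ?(sat_lab_and setting), ?(sat_neg setting),
      ?(sat_and setting) in * by assumption;
    tauto).
  - apply (sat_seq_fml setting); [assumption|]; intros [HG HD].
    rewrite Forall_cons_iff in HD; destruct HD as [Hn HD]; apply Hn.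
    apply (sat_lab_box_unfold setting); [assumption..|]; intros st' O.
    destruct (Hex rho E (proj1 (Forall_forall _ _) HG)
      (proj1 (Forall_forall _ _) HD) st' O) as [st1 [Hphi Hst1]].
    exists st1; split; [assumption|].
    (* Truth values are boolean, so a case split is constructive; the false case refutes the premise
       indexed by [st1]. *)
    destruct (truth M (on_dl rho (DLab (snd st1) (UBox (fst st1) p)))) eqn:T;
      [exact T|].
    exfalso; apply (HP' G (DLab (snd st1) (UBox (fst st1) p) :: D));
      [now exists st1|].
    split; [assumption|]; constructor; [|assumption].
    unfold sat; now rewrite T.
  - apply (sat_seq_fml setting); [assumption|]; intros [HG HD].
    rewrite Forall_cons_iff in HD; destruct HD as [Hn HD]; apply Hn.
    apply (sat_lab_dia setting); [assumption|]; intros Hbox.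
    (* In a countermodel [G] holds and [D] fails, so this valid sequent can only be met by its
       transition; the box then passes to the target state. *)
    pose proof (P_sound _ Hphi rho E) as Htr.
    apply (sat_seq_fml setting) in Htr; [|assumption]; apply Htr.
    split; [assumption|]; constructor; [|assumption]; intros Hst.
    apply (sat_trans setting) in Hst; [|assumption].
    apply (HP' _ _ eq_refl); split; [assumption|]; constructor; [|assumption].
    rewrite (sat_lab_dia setting) by assumption; intros Hdia; apply Hdia.
    exact (sat_lab_box_step setting E Hst Hbox).
  - exact (HV rho E).
  - apply (sat_seq_fml setting); [assumption|]; intros [HG HD].
    (* A countermodel [rho] of the substituted sequent yields the countermodel [rho'] of the
       premise. *)
    destruct (Heta rho E) as [rho' [E' Hrho']].
    pose proof (HP _ eq_refl rho' E') as H.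
    apply (sat_seq_fml setting) in H; [|assumption]; apply H.
    unfold countermodel; rewrite Forall_map in HG, HD.
    split; [revert HG | revert HD]; apply Forall_impl; intros p;
      unfold sat; now rewrite Hrho'.
Qed.
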